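(* Let $\mathbb{F}$ be a field with $\mathrm{char}(\mathbb{F})\notin\{2,3\}$, let $A_4$ be the alternating group of degree $4$ and $C_2$ the cyclic group of order $2$. Then $\beta(A_4\times C_2)=8$.
   Context: For a finite group $G$, a $G$-module is a finite dimensional $\mathbb{F}$-vector space $V$ with a linear action of $G$. $S(V)$ is the symmetric algebra of $V$ (a polynomial algebra on a basis of $V$, with each variable of degree one), on which $G$ acts by $\mathbb{F}$-algebra automorphisms extending the action on $V$, and $S(V)^G$ is the subalgebra of $G$-invariants. $\beta(S(V)^G)$ is the minimal non-negative integer $d$ such that the $\mathbb{F}$-algebra $S(V)^G$ is generated by its homogeneous components of degree at most $d$. The Noether number is $\beta(G)=\sup\{\beta(S(V)^G): V \text{ is a } G\text{-module over }\mathbb{F}\}$. *)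

(* Defs.v *)
From HB Require Import structures.
From mathcomp Require Import all_boot all_order all_algebra all_fingroup.
From mathcomp Require Import all_solvable mxrepresentation mpoly.

Set Implicit Arguments.
Unset Strict Implicit.
Unset Printing Implicit Defensive.

Import GRing.Theory.
Local Open Scope ring_scope.

Inductive subalg_gen (F : fieldType) (A : algType F) (X : A -> Prop) :
    A -> Prop :=
| subalg_gen_mem a of X a : subalg_gen X a
| subalg_gen_scalar (c : F) : subalg_gen X c%:A
| subalg_gen_add a b of subalg_gen X a & subalg_gen X b :
    subalg_gen X (a + b)
| subalg_gen_mul a b of subalg_gen X a & subalg_gen X b :
    subalg_gen X (a * b).

Section Noether.

Variables (F : fieldType) (gT : finGroupType) (G : {group gT}).

Section Module.

Variables (n : nat) (V : mx_representation F G n).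

(* A G-module of dimension n is V = 'rV[F]_n with v acted upon by
   v |-> v *m V g.  Identifying the standard basis of V with the variables
   'X_0, ..., 'X_(n-1), S(V) is {mpoly F[n]}, and the action extends to
   F-algebra automorphisms by substituting for 'X_i the linear form that is
   the image of the i-th basis vector.  MathComp representations act on the
   right; passing to the left action of g^-1 has the same invariants. *)
Definition sym_act (g : gT) (f : {mpoly F[n]}) : {mpoly F[n]} :=
  f \mPo [tuple \sum_(j < n) V g i j *: 'X_j | i < n].

Definition invariant (f : {mpoly F[n]}) : Prop :=
  forall g, g \in G -> sym_act g f = f.

Definition invariant_homog_le (d : nat) (f : {mpoly F[n]}) : Prop :=
  invariant f /\ exists2 k, (k <= d)%N & f \is k.-homog.

Definition invariants_generated_in (d : nat) : Prop :=
  forall f, invariant f -> subalg_gen (invariant_homog_le d) f.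

(* d = beta(S(V)^G) *)
Definition is_beta (d : nat) : Prop :=
  invariants_generated_in d /\
  forall d', invariants_generated_in d' -> (d <= d')%N.

End Module.

(* m = beta(G) over F: m is the least upper bound of all beta(S(V)^G).
   The first clause also asserts that each beta(S(V)^G) exists, so that no
   module is silently left out of the supremum. *)
Definition is_noether_number (m : nat) : Prop :=
  (forall n (V : mx_representation F G n),
     exists2 d, is_beta V d & (d <= m)%N) /\
  (forall m', (forall n (V : mx_representation F G n) d,
                 is_beta V d -> (d <= m')%N) -> (m <= m')%N).

Lemma is_beta_unique n (V : mx_representation F G n) d1 d2 :
  is_beta V d1 -> is_beta V d2 -> d1 = d2.
Proof.
by move=> [g1 l1] [g2 l2]; apply/eqP; rewrite eqn_leq l1 // l2.
Qed.

Lemma is_noether_number_unique m1 m2 :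
  is_noether_number m1 -> is_noether_number m2 -> m1 = m2.
Proof.
have ub m : is_noether_number m ->
    forall n (V : mx_representation F G n) d, is_beta V d -> (d <= m)%N.
  by move=> [e _] n V d bd; have [d' /is_beta_unique/(_ bd) <-] := e n V.
move=> h1 h2; apply/eqP; rewrite eqn_leq.
by rewrite (proj2 h1 _ (ub _ h2)) (proj2 h2 _ (ub _ h1)).
Qed.

End Noether.

Arguments is_noether_number F [gT] G m.

(* C_2 is the additive group of 'Z_2. *)
Definition A4xC2 : {group {perm 'I_4} * 'Z_2} :=
  [group of setX (alt.Alt 'I_4) [set: 'Z_2]].

(* Main.v *)
Require Import Defs.
From HB Require Import structures.
From mathcomp Require Import all_boot all_order all_algebra all_fingroup.
From mathcomp Require Import all_solvable mxrepresentation mpoly qpoly.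
From mathcomp Require Import ring zify.
From Stdlib Require Import Classical.
Import Defs GRing.Theory.
Local Open Scope ring_scope.

Set Implicit Arguments.
Unset Strict Implicit.
Unset Printing Implicit Defensive.

(** G = A_4 x C_2 has the normal subgroup E = V_4 x C_2 = C_2^3; it is generated
by three commuting involutions that a 3-cycle g permutes cyclically, so G is the
wreath product of C_2 by C_3.  Write tau(f) = f + g f + g^2 f for the transfer
from E-invariants to G-invariants.

Upper bound.  Fix a degree d >= 9 and call a form of degree d decomposable when
it lies in a given subspace containing the products of two G-invariants of
positive degree.  As tau is linear over G-invariants, for E-invariants a, b, c of
positive degree tau(abc) and tau(g a . g^2 b . c) agree up to decomposables
([tau_swap]), and from this tau of a product of four E-invariants of positive
degree is decomposable ([tau_four]).  Because 2 and 3 are invertible, every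
invariant of degree d is a combination of elements tau(m), where m is a product
of d linear E-eigenforms whose weights in F_2^3 add up to zero ([form_span]).
Pairing off equal weights leaves a set of distinct weights with sum zero; for
d >= 9 this splits m into four E-invariants, unless the set consists of the seven
nonzero weights, and then [tau_swap] turns m into such a product ([tau_forms]).
So invariants of degree at least 9 are decomposable, and induction on the degree
gives generation in degrees at most 8.

Lower bound.  Let G act by signed permutations on the space with basis the
ordered pairs of points, the generator of C_2 acting as -1.  Let omega be a root
of x^2 + x + 1 and evaluate a polynomial f at s v + e u, where v and u are
eigenvectors of g with eigenvalues omega and omega^2, the Klein group fixes u,
and the sum of the Klein translates of v is zero.  For invariant f, the
coefficient of s^i e^j vanishes unless i + j is even and 3 divides i + 2 j, and
also when i = j = 1.  Hence the coefficient of s^7 e of a product of two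
invariants involves only their constant terms and their own coefficients of
s^7 e ([jet71M]).  It therefore vanishes on everything generated by invariants of
degree at most 7, while it is 18 on an explicit invariant of degree 8. *)

(** * The action on polynomials *)

Section SymAct.

Variables (F : fieldType) (gT : finGroupType) (G : {group gT}).
Variables (n : nat) (V : mx_representation F G n).

HB.instance Definition _ g :=
  GRing.Linear.copy (sym_act V g)
    (comp_mpoly [tuple \sum_(j < n) V g i j *: 'X_j | i < n]).
HB.instance Definition _ g :=
  GRing.RMorphism.copy (sym_act V g)
    (comp_mpoly [tuple \sum_(j < n) V g i j *: 'X_j | i < n]).

Lemma sym_actX g i : sym_act V g 'X_i = \sum_(j < n) V g i j *: 'X_j.
Proof. by rewrite /sym_act comp_mpolyXU -tnth_nth tnth_mktuple. Qed.

Lemma mpoly_lrmorph_ext (A : algType F) (p q : {lrmorphism {mpoly F[n]} -> A}) :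
  (forall i, p 'X_i = q 'X_i) -> p =1 q.
Proof.
move=> epq f; rewrite [f]mpolyE !linear_sum; apply: eq_bigr => m _.
rewrite !linearZ /=; congr (_ *: _).
rewrite mpolyXE_id !rmorph_prod; apply: eq_bigr => i _.
by rewrite !rmorphXn /= epq.
Qed.

(** Substitution reverses the order of composition, hence the product [h * g]. *)
Lemma sym_act_comp g h f : g \in G -> h \in G ->
  sym_act V g (sym_act V h f) = sym_act V (h * g)%g f.
Proof.
move=> gG hG.
have := @mpoly_lrmorph_ext _ (sym_act V g \o sym_act V h) (sym_act V (h * g)%g).
apply=> i /=.
rewrite !sym_actX linear_sum /= repr_mxM //.
under eq_bigr => j _ do rewrite linearZ /= sym_actX scaler_sumr.
rewrite exchange_big; apply: eq_bigr => k _ /=.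
by rewrite mxE scaler_suml; apply: eq_bigr => j _; rewrite scalerA.
Qed.

Lemma sym_act1 f : sym_act V 1%g f = f.
Proof.
have := @mpoly_lrmorph_ext _ (sym_act V 1%g) idfun.
apply=> i /=; rewrite sym_actX repr_mx1 (bigD1 i) //= big1 ?addr0.
  by rewrite mxE eqxx scale1r.
by move=> j ji; rewrite mxE eq_sym (negPf ji) scale0r.
Qed.

Lemma sym_act_homog g d f : f \is d.-homog -> sym_act V g f \is d.-homog.
Proof.
move=> /dhomogP hf; rewrite [f]mpolyE linear_sum /=.
rewrite big_seq; apply: rpred_sum => m mf; rewrite linearZ /=; apply: rpredZ.
rewrite -(hf m mf) /= mdegE mpolyXE_id rmorph_prod /=.
elim/big_rec2: _ => [|i k p _ hp]; first exact: dhomog1.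
rewrite dhomogM // rmorphXn /= -[X in X.-homog]mul1n dhomogMn // sym_actX.
apply: rpred_sum => j _; apply: rpredZ; by rewrite dhomogX /= mdeg1.
Qed.

Lemma sym_act_pihomog g d f :
  sym_act V g (pihomog mdeg d f) = pihomog mdeg d (sym_act V g f).
Proof.
set k := mmeasure mdeg f.
have homk e : sym_act V g (pihomog mdeg e f) \is e.-homog.
  exact/sym_act_homog/pihomogP.
have -> : sym_act V g f = \sum_(i < k) sym_act V g (pihomog mdeg i f).
  by rewrite -raddf_sum -pihomog_partitionE.
have -> : pihomog mdeg d (\sum_(i < k) sym_act V g (pihomog mdeg i f)) =
    \sum_(i < k) pihomog mdeg d (sym_act V g (pihomog mdeg i f)).
  exact: raddf_sum.
have [dk|kd] := ltnP d k.
  rewrite [RHS](bigD1 (Ordinal dk)) // [X in _ = _ + X]big1 ?addr0; last first.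
    by move=> i ne; rewrite (pihomog_ne0 _ (homk i)).
  by rewrite [RHS]pihomog_dE.
rewrite [RHS]big1; last first.
  move=> i _; rewrite (pihomog_ne0 _ (homk i)) // neq_ltn.
  by rewrite (leq_trans (ltn_ord i) kd).
suff -> : pihomog mdeg d f = 0 by rewrite raddf0.
rewrite pihomogE big1_seq // => m /andP[/eqP dm mf].
by move: kd; rewrite -dm leqNgt mmeasure_mnm_lt.
Qed.

Lemma invariant_gen (X : {set gT}) f : X \subset G -> G \subset <<X>>%g ->
  (forall x, x \in X -> sym_act V x f = f) -> invariant V f.
Proof.
move=> XG GX Xf.
have grpH : group_set [set x in G | sym_act V x f == f].
  apply/group_setP; split=> [|x y].
    by rewrite in_set group1 sym_act1 eqxx.
  rewrite !in_set => /andP[xG /eqP xf] /andP[yG /eqP yf].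
  by rewrite groupM // -sym_act_comp // xf yf eqxx.
have /subsetP sub : G \subset Group grpH.
  apply: subset_trans GX _; rewrite gen_subG; apply/subsetP => x xX.
  by rewrite in_set (subsetP XG) //= Xf.
by move=> x /sub; rewrite in_set => /andP[_ /eqP].
Qed.

End SymAct.

(** * Zero-sum sets of weights in F_2^3 *)

(** Characters of C_2^3: the coordinate i tells whether the i-th involution acts
by -1. *)
Definition wt := (bool * bool * bool)%type.
Definition wt0 : wt := (false, false, false).
Definition addw (u v : wt) : wt :=
  (u.1.1 (+) v.1.1, u.1.2 (+) v.1.2, u.2 (+) v.2).
(** How the element of order 3 moves the weight of an eigenvector. *)
Definition rotw (u : wt) : wt := (u.2, u.1.1, u.1.2).

Lemma addwA : associative addw.
Proof. by move=> [[? ?] ?] [[? ?] ?] [[? ?] ?]; rewrite /addw /= !addbA. Qed.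
Lemma addwC : commutative addw.
Proof.
by move=> [[a b] c] [[x y] z]; rewrite /addw /= (addbC a) (addbC b) (addbC c).
Qed.
Lemma add0w : left_id wt0 addw.
Proof. by move=> [[? ?] ?]. Qed.
Lemma addww u : addw u u = wt0.
Proof. by case: u => [[? ?] ?]; rewrite /addw /= !addbb. Qed.

HB.instance Definition _ := Monoid.isComLaw.Build wt wt0 addw addwA addwC add0w.

Definition nzwts : seq wt :=
  [:: (true, false, false); (false, true, false); (false, false, true);
      (false, true, true); (true, false, true); (true, true, false);
      (true, true, true)].
Definition wts : seq wt := wt0 :: nzwts.

Lemma mem_wts w : w \in wts.
Proof. by case: w => [[[] []] []]. Qed.

(** The seven nonzero weights split into a plane minus 0 and its complement; any
other zero-sum set of distinct nonzero weights is left in one piece. *)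
Definition zero_parts (r : seq wt) : seq (seq wt) :=
  let r' := filter (predC1 wt0) r in
  (if wt0 \in r then [:: [:: wt0]] else [::]) ++
  (if r' == nzwts then
     [:: [:: (true, false, false); (false, true, false); (true, true, false)];
         [:: (false, false, true); (false, true, true); (true, false, true);
             (true, true, true)]]
   else if r' is [::] then [::] else [:: r']).

(** This is what decides whether a zero-sum sequence of length n >= 9 has four
zero-sum parts: it consists of pairs of equal weights and of a zero-sum set r, so
the bound 2 * size ps + 2 on size r yields (n - size r) / 2 + size ps >= 4.  The
exception has 1 + 2 parts when n = 9.  The proof runs through the 256 subsets. *)
Lemma zero_partsP (r : seq wt) : uniq r -> \big[addw/wt0]_(w <- r) w = wt0 ->
  exists ps : seq (seq wt),
  [/\ perm_eq r (flatten ps),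
      {in ps, forall p, p != [::] /\ \big[addw/wt0]_(w <- p) w = wt0} &
      (size r <= (size ps).*2 + 2)%N \/ perm_eq r nzwts].
Proof.
move=> ur; pose c := mem r.
have pr : perm_eq r (filter c wts).
  apply: uniq_perm; rewrite ?filter_uniq // => w.
  by rewrite mem_filter mem_wts andbT.
pose sz (p : seq wt) := (p != [::]) && (foldr addw wt0 p == wt0).
pose ok s := let ps := zero_parts s in (foldr addw wt0 s == wt0) ==>
  [&& perm_eq s (flatten ps), all sz ps &
      (size s <= (size ps).*2 + 2)%N || (s == nzwts)].
have allok b0 b1 b2 b3 b4 b5 b6 b7 :
    ok (mask [:: b0; b1; b2; b3; b4; b5; b6; b7] wts).
  by case: b0; case: b1; case: b2; case: b3; case: b4; case: b5; case: b6; case: b7.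
have : ok (filter c wts) by rewrite filter_mask; apply: allok.
rewrite (perm_big _ pr) -foldrE => /implyP okc /eqP/okc/and3P[h1 h2 h3].
exists (zero_parts (filter c wts)); split.
- exact: perm_trans pr h1.
- by move=> p /(allP h2) /andP[? /eqP]; rewrite -foldrE.
- rewrite (perm_size pr); case/orP: h3 => h; [by left | right].
  by rewrite (eqP h) in pr.
Qed.

(** * Decomposable invariants of the wreath product of C_2 by C_3 *)

(** The argument uses only a commutative algebra with a degree, spanned in degree
d by the products of d elements of degree 1, on which three commuting involutions
r1, r2, r3 and an automorphism g of order 3 permuting them act in a
degree-preserving way.  Below, E is the group generated by r1, r2 and r3. *)
Section Wreath.

Variables (F : fieldType) (A : comAlgType F).
Hypotheses (two_neq0 : 2%:R != 0 :> F) (three_neq0 : 3%:R != 0 :> F).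

Variable hom : nat -> A -> Prop.
Hypothesis hom0 : forall d, hom d 0.
Hypothesis hom1 : hom 0 1.
Hypothesis homD : forall d f h, hom d f -> hom d h -> hom d (f + h).
Hypothesis homZ : forall d c f, hom d f -> hom d (c *: f).
Hypothesis homM : forall d e f h, hom d f -> hom e h -> hom (d + e) (f * h).
Hypothesis hom_span : forall d (Q : A -> Prop), Q 0 ->
  (forall f h, Q f -> Q h -> Q (f + h)) -> (forall c f, Q f -> Q (c *: f)) ->
  (forall ys : seq A, size ys = d -> (forall y, y \in ys -> hom 1 y) ->
     Q (\prod_(y <- ys) y)) ->
  forall f, hom d f -> Q f.

Variables r1 r2 r3 g : {lrmorphism A -> A}.
Hypotheses (hom_r1 : forall d f, hom d f -> hom d (r1 f))
  (hom_r2 : forall d f, hom d f -> hom d (r2 f))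
  (hom_r3 : forall d f, hom d f -> hom d (r3 f))
  (hom_g : forall d f, hom d f -> hom d (g f)).
Hypotheses (r1K : involutive r1) (r2K : involutive r2) (r3K : involutive r3)
  (gK : forall f, g (g (g f)) = f).
Hypotheses (r12 : forall f, r1 (r2 f) = r2 (r1 f))
  (r13 : forall f, r1 (r3 f) = r3 (r1 f)) (r23 : forall f, r2 (r3 f) = r3 (r2 f)).
Hypotheses (r1g : forall f, r1 (g f) = g (r3 f))
  (r2g : forall f, r2 (g f) = g (r1 f)) (r3g : forall f, r3 (g f) = g (r2 f)).

Definition wreath_invariant (f : A) :=
  [/\ r1 f = f, r2 f = f, r3 f = f & g f = f].

Definition eigen (w : wt) (f : A) :=
  [/\ r1 f = (-1) ^+ w.1.1 *: f, r2 f = (-1) ^+ w.1.2 *: f &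
      r3 f = (-1) ^+ w.2 *: f].

Lemma eigenM u v f h : eigen u f -> eigen v h -> eigen (addw u v) (f * h).
Proof.
move=> [f1 f2 f3] [h1 h2 h3]; split; rewrite rmorphM /=.
- by rewrite f1 h1 -scalerAl -scalerAr scalerA signr_addb.
- by rewrite f2 h2 -scalerAl -scalerAr scalerA signr_addb.
- by rewrite f3 h3 -scalerAl -scalerAr scalerA signr_addb.
Qed.

Lemma eigen_g w f : eigen w f -> eigen (rotw w) (g f).
Proof.
move=> [f1 f2 f3]; split; rewrite ?r1g ?r2g ?r3g.
- by rewrite f3 linearZ.
- by rewrite f1 linearZ.
- by rewrite f2 linearZ.
Qed.

Definition tau f := f + g f + g (g f).

Lemma tauD f h : tau (f + h) = tau f + tau h.
Proof. by rewrite /tau !raddfD /=; ring. Qed.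

Lemma tauZ c f : tau (c *: f) = c *: tau f.
Proof. by rewrite /tau !linearZ /= -!scalerDr. Qed.

Lemma tau_g f : tau (g f) = tau f.
Proof. by rewrite /tau gK addrC addrA. Qed.

Lemma hom_tau d f : hom d f -> hom d (tau f).
Proof. by move=> hf; do !apply: homD => //; do !apply: hom_g. Qed.

Lemma tau_invariant f : eigen wt0 f -> wreath_invariant (tau f).
Proof.
move=> f0.
have fix_ h : eigen wt0 h -> [/\ r1 h = h, r2 h = h & r3 h = h].
  by move=> [-> -> ->]; rewrite /= expr0 scale1r.
have [f1 f2 f3] := fix_ _ f0.
have [g1 g2 g3] := fix_ _ (eigen_g f0).
have [k1 k2 k3] := fix_ _ (eigen_g (eigen_g f0)).
split; rewrite /tau !raddfD /=.
- by rewrite f1 g1 k1.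
- by rewrite f2 g2 k2.
- by rewrite f3 g3 k3.
- by rewrite gK addrC addrA.
Qed.

(** E-invariants of positive degree.  The degree is carried along because the
element 0 does not determine it. *)
Definition block (x : nat * A) :=
  [/\ (0 < x.1)%N, eigen wt0 x.2 & hom x.1 x.2].

Lemma blockM x y : block x -> block y -> block ((x.1 + y.1)%N, x.2 * y.2).
Proof.
move=> [x0 xe xh] [y0 ye yh]; split=> /=; first by rewrite addn_gt0 x0.
  by rewrite -(addww wt0); exact: eigenM.
exact: homM.
Qed.

Lemma block_g x : block x -> block (x.1, g x.2).
Proof.
move=> [x0 xe xh]; split=> //=; last exact: hom_g.
exact: (eigen_g xe).
Qed.

Lemma block_prod (bs : seq (nat * A)) : bs != [::] ->
  (forall x, x \in bs -> block x) ->
  block ((\sum_(x <- bs) x.1)%N, \prod_(x <- bs) x.2).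
Proof.
elim: bs => [//|x [|y bs] IH] _ bbs.
  rewrite !big_seq1; have := bbs x (mem_head _ _).
  by case: (x).
rewrite [X in block (X, _)]big_cons [X in block (_, X)]big_cons.
apply: (@blockM x (_, _)); first exact: bbs (mem_head _ _).
by apply: IH => // z zs; apply: bbs; rewrite inE zs orbT.
Qed.

Definition form (x : wt * A) := eigen x.1 x.2 /\ hom 1 x.2.

Lemma form_prod (xs : seq (wt * A)) : (forall x, x \in xs -> form x) ->
  eigen (\big[addw/wt0]_(x <- xs) x.1) (\prod_(x <- xs) x.2) /\
  hom (size xs) (\prod_(x <- xs) x.2).
Proof.
elim: xs => [|x xs IH] xsf.
  by rewrite !big_nil; split=> //; split; rewrite rmorph1 /= expr0 scale1r.
have [xe xh] := xsf x (mem_head _ _).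
have [|IHe IHh] := IH; first by move=> y ys; apply: xsf; rewrite inE ys orbT.
by rewrite !big_cons; split; [exact: eigenM | exact: (homM xh IHh)].
Qed.

Lemma form_block (xs : seq (wt * A)) : xs != [::] ->
  (forall x, x \in xs -> form x) -> \big[addw/wt0]_(x <- xs) x.1 = wt0 ->
  block (size xs, \prod_(x <- xs) x.2).
Proof.
move=> xs0 /form_prod[xe xh] xw; split=> //=; last by rewrite -xw.
by rewrite lt0n size_eq0.
Qed.

(** The projection onto the (-1)^b-eigenspace of an involution r. *)
Definition sign_part (r : A -> A) (b : bool) (f : A) :=
  2%:R^-1 *: (f + (-1) ^+ b *: r f).

Lemma sign_part_sum r f : sign_part r false f + sign_part r true f = f.
Proof.
rewrite /sign_part expr0 expr1 scale1r scaleN1r -scalerDr addrACA subrr addr0.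
by rewrite -mulr2n -scaler_nat scalerA mulVf // scale1r.
Qed.

Lemma sign_part_eigen (r : {lrmorphism A -> A}) (b c : bool) f :
  r f = (-1) ^+ b *: f -> sign_part r c f = if b == c then f else 0.
Proof.
have half (h : A) : 2%:R^-1 *: (h + h) = h.
  by rewrite -mulr2n -scaler_nat scalerA mulVf // scale1r.
move=> rf; rewrite /sign_part rf; case: b {rf}; case: c => /=;
  by rewrite ?expr1 ?expr0 ?scaleN1r ?scale1r ?opprK ?half ?addNr ?subrr ?scaler0.
Qed.

Lemma sign_partK (r : {lrmorphism A -> A}) (b : bool) f : involutive r ->
  r (sign_part r b f) = (-1) ^+ b *: sign_part r b f.
Proof.
move=> rK; rewrite /sign_part linearZ linearD linearZ /= rK; case: b.
  by rewrite expr1 !scaleN1r -scalerN opprB addrC.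
by rewrite expr0 !scale1r addrC.
Qed.

Lemma sign_part_comm (q r : {lrmorphism A -> A}) b c f :
  (forall h, q (r h) = r (q h)) -> q f = c *: f ->
  q (sign_part r b f) = c *: sign_part r b f.
Proof.
move=> qr qf; rewrite /sign_part linearZ linearD linearZ /= qr qf linearZ /=.
by rewrite [_ *: (c *: _)]scalerA [_ * c]mulrC -scalerA -scalerDr scalerA mulrC -scalerA.
Qed.

(** As r1, r2 and r3 commute, projecting onto eigenspaces of each in turn yields
common eigenvectors. *)
Lemma form_split y : hom 1 y ->
  exists2 l : wt -> A, forall w, form (w, l w) & y = \sum_(w <- wts) l w.
Proof.
move=> hy; pose l (w : wt) :=
  sign_part r3 w.2 (sign_part r2 w.1.2 (sign_part r1 w.1.1 y)).
have hsp r b f : (forall d f, hom d f -> hom d (r f)) ->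
    hom 1 f -> hom 1 (sign_part r b f).
  by move=> hr hf; apply: homZ; apply: homD => //; apply: homZ; apply: hr.
exists l => [w|].
  split=> /=; last exact: (hsp _ _ _ hom_r3 (hsp _ _ _ hom_r2 (hsp _ _ _ hom_r1 hy))).
  split=> /=.
  - by apply: sign_part_comm => //; apply: sign_part_comm => //; apply: sign_partK.
  - by apply: sign_part_comm => //; apply: sign_partK.
  - exact: sign_partK.
rewrite !big_cons big_nil addr0 /l /=.
set y0 := sign_part r1 false y; set y1 := sign_part r1 true y.
rewrite -[LHS](sign_part_sum r1) -/y0 -/y1.
rewrite -[X in X + _ = _](sign_part_sum r2) -[X in _ + X = _](sign_part_sum r2).
set y00 := sign_part r2 _ y0; set y01 := sign_part r2 _ y0.
set y10 := sign_part r2 _ y1; set y11 := sign_part r2 _ y1.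
have E := sign_part_sum r3.
rewrite -{1}(E y00) -{1}(E y01) -{1}(E y10) -{1}(E y11).
move: (sign_part r3) => h; ring.
Qed.

Lemma form_span d (Q : A -> Prop) : Q 0 ->
  (forall f h, Q f -> Q h -> Q (f + h)) -> (forall c f, Q f -> Q (c *: f)) ->
  (forall xs : seq (wt * A), size xs = d -> (forall x, x \in xs -> form x) ->
     Q (\prod_(x <- xs) x.2)) ->
  forall f, hom d f -> Q f.
Proof.
move=> Q0 QD QZ Qf; apply: hom_span => // ys szys ysh.
suff gen (xs : seq (wt * A)) : (size xs + size ys)%N = d ->
    (forall x, x \in xs -> form x) ->
    Q (\prod_(x <- xs) x.2 * \prod_(y <- ys) y).
  by have := gen [::]; rewrite big_nil mul1r; apply.
elim: ys ysh xs {szys} => [|y ys IH] ysh xs szxs xsf.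
  by rewrite big_nil mulr1; apply: Qf; rewrite // -szxs addn0.
have [l lf yE] := form_split (ysh y (mem_head _ _)).
rewrite big_cons {1}yE mulr_suml mulr_sumr.
apply: (big_ind Q) => // w _.
rewrite mulrCA mulrA.
have := IH _ ((w, l w) :: xs); rewrite big_cons /=; apply.
- by move=> z zs; apply: ysh; rewrite inE zs orbT.
- by rewrite -szxs addSnnS.
- by move=> x; rewrite inE => /predU1P[->//|]; apply: xsf.
Qed.

(** [P] stands for the decomposable elements: a subspace that contains the products
of invariants of positive degrees with sum d. *)
Section Degree.

Variables (P : A -> Prop) (d : nat).
Hypothesis PD : forall f h, P f -> P h -> P (f + h).
Hypothesis PZ : forall c f, P f -> P (c *: f).
Hypothesis PM : forall i j f h, (0 < i)%N -> (0 < j)%N -> (i + j = d)%N ->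
  wreath_invariant f -> wreath_invariant h -> hom i f -> hom j h ->
  P (f * h).

Lemma P_opp f : P f -> P (- f).
Proof. by rewrite -scaleN1r; apply: PZ. Qed.

Lemma P_third f : P (f *+ 3) -> P f.
Proof.
by move=> /(PZ 3%:R^-1); rewrite -scaler_nat scalerA mulVf // scale1r.
Qed.

Lemma PtauM x y : block x -> block y -> (x.1 + y.1 = d)%N ->
  P (tau x.2 * tau y.2).
Proof.
move=> [x0 xe xh] [y0 ye yh] xyd.
by apply: (PM x0 y0 xyd); by [apply: tau_invariant | apply: hom_tau].
Qed.

(** Write T(i, j) = tau(g^i a . g^j b . c) for i, j modulo 3.  Since tau is linear
over invariants, the sums of T over the lines of directions (1,0), (0,1) and
(1,1) are decomposable.  Adding the three such lines through a point counts the
point three times and every point off its line of direction (1,-1) once.  So,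
modulo decomposables, 3 T is constant on lines of direction (1,-1). *)
Lemma tau_swap x y z : block x -> block y -> block z ->
  (x.1 + y.1 + z.1 = d)%N ->
  P (tau (x.2 * y.2 * z.2) - tau (g x.2 * g (g y.2) * z.2)).
Proof.
move=> bx by_ bz xyzd.
have bgx := block_g bx; have bggy := block_g (block_g by_).
apply: P_third.
have -> : (tau (x.2 * y.2 * z.2) - tau (g x.2 * g (g y.2) * z.2)) *+ 3
  = (tau x.2 * tau (y.2 * z.2) - tau x.2 * tau (g (g y.2) * z.2))
  + (tau y.2 * tau (x.2 * z.2) - tau y.2 * tau (g x.2 * z.2))
  + (tau z.2 * tau (x.2 * y.2) - tau z.2 * tau (g x.2 * g (g y.2))).
  by rewrite /tau !rmorphM /= !gK; ring.
have yz := blockM by_ bz; have gyz := blockM bggy bz.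
have xz := blockM bx bz; have gxz := blockM bgx bz.
have xy := blockM bx by_; have gxy := blockM bgx bggy.
do !apply: PD; try apply: P_opp.
- by apply: (PtauM bx yz); rewrite /= addnA.
- by apply: (PtauM bx gyz); rewrite /= addnA.
- by apply: (PtauM by_ xz); rewrite /= addnA (addnC y.1).
- by apply: (PtauM by_ gxz); rewrite /= addnA (addnC y.1).
- by apply: (PtauM bz xy); rewrite /= addnC.
- by apply: (PtauM bz gxy); rewrite /= addnC.
Qed.

(** With four factors the swaps also allow z to be replaced by g z alone: swap (x, w),
apply g, and swap (x, y).  Hence 3 tau(xyzw) is congruent to the sum over the
translates of z, which is tau(z) tau(xyw). *)
Lemma tau_four x y z w : block x -> block y -> block z -> block w ->
  (x.1 + y.1 + z.1 + w.1 = d)%N -> P (tau (x.2 * y.2 * z.2 * w.2)).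
Proof.
move=> bx by_ bz bw dE.
have gE u : block u -> u.1 = z.1 ->
    P (tau (x.2 * y.2 * u.2 * w.2) - tau (x.2 * y.2 * g u.2 * w.2)).
  move=> bu uz.
  have s1 := tau_swap bx bw (blockM by_ bu).
  have s2 := tau_swap (block_g (block_g bx)) (block_g by_) (blockM (block_g bu) bw).
  have -> : tau (x.2 * y.2 * u.2 * w.2) - tau (x.2 * y.2 * g u.2 * w.2) =
    (tau (x.2 * w.2 * (y.2 * u.2)) -
       tau (g x.2 * g (g w.2) * (y.2 * u.2))) +
    (tau (g (g x.2) * g y.2 * (g u.2 * w.2)) -
       tau (g (g (g x.2)) * g (g (g y.2)) *
         (g u.2 * w.2))).
    rewrite !gK -(tau_g (g x.2 * _ * _)) !rmorphM /= gK.
    rewrite (_ : x.2 * w.2 * (y.2 * u.2) = x.2 * y.2 * u.2 * w.2); last by ring.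
    rewrite (_ : x.2 * y.2 * (g u.2 * w.2) = x.2 * y.2 * g u.2 * w.2);
      last by ring.
    rewrite (_ : g (g x.2) * w.2 * (g y.2 * g u.2) =
      g (g x.2) * g y.2 * (g u.2 * w.2)); last by ring.
    by ring.
  apply: PD.
    by apply: s1; rewrite /= -dE uz; ring.
  by apply: s2; rewrite /= -dE uz; ring.
have e1 := gE z bz erefl; have e2 := gE _ (block_g bz) erefl.
apply: P_third.
have -> : tau (x.2 * y.2 * z.2 * w.2) *+ 3 =
  tau z.2 * tau (x.2 * y.2 * w.2) +
   (tau (x.2 * y.2 * z.2 * w.2) - tau (x.2 * y.2 * g z.2 * w.2)) *+ 2 +
   (tau (x.2 * y.2 * g z.2 * w.2) - tau (x.2 * y.2 * g (g z.2) * w.2)).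
  have -> : tau z.2 * tau (x.2 * y.2 * w.2) = tau (x.2 * y.2 * z.2 * w.2) +
     tau (x.2 * y.2 * g z.2 * w.2) + tau (x.2 * y.2 * g (g z.2) * w.2).
    by rewrite /tau !rmorphM /= !gK; ring.
  by ring.
apply: PD => //; apply: PD; last by rewrite -scaler_nat; apply: PZ.
by apply: (PtauM bz (blockM (blockM bx by_) bw)); rewrite /= -dE; ring.
Qed.

Lemma tau_many (bs : seq (nat * A)) : (forall x, x \in bs -> block x) ->
  (4 <= size bs)%N -> ((\sum_(x <- bs) x.1)%N = d)%N ->
  P (tau (\prod_(x <- bs) x.2)).
Proof.
case: bs => [|x [|y [|z [|w bs]]]] // bbs _.
rewrite !big_cons => dE.
have bx : block x by apply: bbs; rewrite !inE eqxx.
have by_ : block y by apply: bbs; rewrite !inE eqxx !orbT.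
have bz : block z by apply: bbs; rewrite !inE eqxx !orbT.
have bw : block w by apply: bbs; rewrite !inE eqxx !orbT.
have : block ((\sum_(x <- w :: bs) x.1)%N, \prod_(x <- w :: bs) x.2).
  by apply: block_prod => // u us; apply: bbs; rewrite !in_cons -in_cons us !orbT.
rewrite !big_cons => /(tau_four bx by_ bz) /=; rewrite !mulrA; apply.
by rewrite -dE !addnA.
Qed.

(** Two eigenforms of equal weight have an E-invariant product, so at most one
factor of each weight remains unpaired. *)
Lemma pair_off (xs : seq (wt * A)) : (forall x, x \in xs -> form x) ->
  exists (bs : seq (nat * A)) (r : seq wt) (l : wt -> A),
  [/\ uniq r, forall w, form (w, l w),
      (forall x, x \in bs -> block x /\ x.1 = 2%N),
      \prod_(x <- xs) x.2 = \prod_(x <- bs) x.2 * \prod_(w <- r) l w &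
      size xs = ((size bs).*2 + size r)%N /\
      \big[addw/wt0]_(x <- xs) x.1 = \big[addw/wt0]_(w <- r) w].
Proof.
elim: xs => [|[w y] xs IH] xsf.
  exists [::], [::], (fun=> 0); split; rewrite ?big_nil ?mulr1 // => w.
  by split=> //=; split; rewrite raddf0 scaler0.
have [|bs [r [l [ur lf bsb xsE [szE wE]]]]] := IH.
  by move=> x xx; apply: xsf; rewrite inE xx orbT.
have yf : form (w, y) by apply: xsf; rewrite inE eqxx.
rewrite !big_cons /= xsE wE szE.
have [wr|wr] := boolP (w \in r).
  exists ((2%N, y * l w) :: bs), (rem w r), l; split=> //.
  - exact: rem_uniq.
  - move=> x; rewrite inE => /predU1P[-> /=|]; last exact: bsb.
    have [ye yh] := yf; have [le lh] := lf w.
    split=> //; split=> //=; last exact: (homM yh lh).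
    by rewrite -(addww w); exact: eigenM.
  - rewrite big_cons /= (perm_big _ (perm_to_rem wr)) big_cons /=.
    by rewrite -!mulrA; congr (_ * _); rewrite mulrCA.
  - rewrite (perm_size (perm_to_rem wr)) /= doubleS addnS !addSn; split=> //.
    by rewrite (perm_big _ (perm_to_rem wr)) big_cons /= addwA addww add0w.
exists bs, (w :: r), (fun v => if v == w then y else l v); split=> //.
- by rewrite /= wr.
- by move=> v; have [->|_] := eqVneq v w; [exact: yf | exact: lf].
- rewrite big_cons eqxx mulrCA; congr (_ * (_ * _)).
  rewrite !big_seq; apply: eq_bigr => v vr; case: eqP => // vw.
  by rewrite -vw vr in wr.
- by rewrite big_cons /= addnS.
Qed.

(** Let the unpaired weights be all seven nonzero ones, and B the product of the
pairs.  Take a = f1 e2 e3 and its complement c = e1 f2 f3 s.  In g a . c the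
weights of e1 and f2 occur twice, so swapping (a, B) produces a product of four
E-invariants. *)
Lemma tau_forms (xs : seq (wt * A)) : (9 <= d)%N -> size xs = d ->
  (forall x, x \in xs -> form x) ->
  \big[addw/wt0]_(x <- xs) x.1 = wt0 -> P (tau (\prod_(x <- xs) x.2)).
Proof.
move=> d9 szxs xsf wxs.
have [bs [r [l [ur lf bsb -> [szE wE]]]]] := pair_off xsf.
rewrite wE in wxs.
have [ps [prm psP psn]] := zero_partsP ur wxs.
have bsd : (\sum_(x <- bs) x.1)%N = (size bs).*2.
  rewrite big_seq (eq_bigr (fun=> 2%N)); last by move=> x /bsb[].
  by rewrite -big_seq big_const_seq count_predT iter_addn_0 mul2n.
case: psn => [szr|rn].
  pose cs : seq (nat * A) := [seq (size p, \prod_(w <- p) l w) | p <- ps].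
  have -> : \prod_(w <- r) l w = \prod_(x <- cs) x.2.
    by rewrite (perm_big _ prm) big_flatten big_map.
  rewrite -big_cat; apply: tau_many.
  - move=> x; rewrite mem_cat => /orP[/bsb[]//|/mapP[p /psP[p0 pw] ->]].
    have := @form_block [seq (w, l w) | w <- p].
    rewrite !big_map size_map; apply=> //; first by case: (p) p0.
    by move=> y /mapP[w _ ->].
  - by rewrite size_cat size_map; lia.
  - rewrite big_cat /= bsd big_map /= -szxs szE (perm_size prm) size_flatten.
    by rewrite sumnE big_map.
rewrite (perm_big _ rn) /=.
have szr : size r = 7%N by rewrite (perm_size rn).
pose B := \prod_(x <- bs) x.2.
have bB : block ((size bs).*2, B).
  rewrite -bsd; apply: block_prod => [|x /bsb[]//].
  by case: (bs) szE szxs d9 => //= + <-; rewrite szr => ->.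
(* The weights of e1, e2, e3 and of f1, f2, f3 are orbits; that of s is fixed. *)
pose e1 := l (true, false, false); pose e2 := l (false, true, false).
pose e3 := l (false, false, true); pose f1 := l (false, true, true).
pose f2 := l (true, false, true); pose f3 := l (true, true, false).
pose s := l (true, true, true).
have blk (p : seq (wt * A)) := @form_block p.
have b1 : block (3, f1 * e2 * e3).
  have := blk [:: ((false, true, true), f1); ((false, true, false), e2);
     ((false, false, true), e3)].
  rewrite !big_cons !big_nil mulr1 /= mulrA; apply=> //.
  by move=> x; rewrite !inE => /or3P[] /eqP ->; exact: lf.
have b2 : block (4, e1 * f2 * f3 * s).
  have := blk [:: ((true, false, false), e1); ((true, false, true), f2);
     ((true, true, false), f3); ((true, true, true), s)].
  rewrite !big_cons !big_nil mulr1 /= !mulrA; apply=> //.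
  by move=> x; rewrite !inE => /or4P[] /eqP ->; exact: lf.
have gform w : form (rotw w, g (l w)).
  by have [le lh] := lf w; split; [exact: eigen_g | exact: hom_g].
have b3 : block (2, g f1 * f2).
  have := blk [:: ((true, false, true), g f1); ((true, false, true), f2)].
  rewrite !big_cons !big_nil mulr1 /=; apply=> //.
  move=> x; rewrite !inE => /orP[] /eqP ->; last exact: lf.
  exact: (gform (false, true, true)).
have b4 : block (2, g e3 * e1).
  have := blk [:: ((true, false, false), g e3); ((true, false, false), e1)].
  rewrite !big_cons !big_nil mulr1 /=; apply=> //.
  move=> x; rewrite !inE => /orP[] /eqP ->; last exact: lf.
  exact: (gform (false, false, true)).
have b5 : block (3, g e2 * f3 * s).
  have := blk [:: ((false, false, true), g e2); ((true, true, false), f3);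
     ((true, true, true), s)].
  rewrite !big_cons !big_nil mulr1 /= mulrA; apply=> //.
  move=> x; rewrite !inE => /or3P[] /eqP ->; try exact: lf.
  exact: (gform (false, true, false)).
have dE : (3 + (size bs).*2 + 4 = d)%N by rewrite -szxs szE szr; lia.
have := tau_swap b1 bB b2 dE.
have : P (tau (g f1 * f2 * (g e3 * e1) * (g e2 * f3 * s) * g (g B))).
  apply: (tau_four b3 b4 b5 (block_g (block_g bB))).
  by rewrite /= -dE; lia.
move=> p1 /PD/(_ p1) /=; set z := tau (g f1 * _ * _ * _ * _).
rewrite (_ : tau (g _ * _ * _) = z); last first.
  by rewrite /z !rmorphM /=; congr tau; ring.
rewrite subrK !big_cons big_nil mulr1.
by congr (P (tau _)); rewrite /B -/e1 -/e2 -/e3 -/f1 -/f2 -/f3 -/s /=; ring.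
Qed.

(** On a product of eigenforms the averaging over E is the identity or zero according
to whether the weights add up to zero; composed with tau it reduces an invariant
to the products treated in [tau_forms]. *)
Theorem wreath_decomposable f : (9 <= d)%N -> hom d f -> wreath_invariant f ->
  P f.
Proof.
move=> d9 hf [f1 f2 f3 fg].
have spZ (r : {lrmorphism A -> A}) c (h : A) :
    sign_part r false (c *: h) = c *: sign_part r false h.
  by rewrite /sign_part !expr0 !scale1r linearZ -scalerDr !scalerA mulrC.
have spD (r : {lrmorphism A -> A}) (h k : A) :
    sign_part r false (h + k) = sign_part r false h + sign_part r false k.
  by rewrite /sign_part !expr0 !scale1r (raddfD r) addrACA scalerDr.
have sp0 (r : {lrmorphism A -> A}) : sign_part r false 0 = 0.
  by rewrite -(scale0r 0) spZ !scale0r.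
pose avg h := sign_part r3 false (sign_part r2 false (sign_part r1 false h)).
have PavgZ c h : P (tau (avg h)) -> P (tau (avg (c *: h))).
  move=> ph; rewrite /avg (spZ r1) (spZ r2) (spZ r3) tauZ; exact: (PZ _ ph).
suff : P (tau (avg f)).
  have fixE (r : {lrmorphism A -> A}) : r f = f -> sign_part r false f = f.
    by move=> rf; rewrite (@sign_part_eigen _ false) // expr0 scale1r.
  rewrite /avg !fixE // /tau fg fg => h; apply: P_third; move: h.
  by congr P; ring.
have tau0 : tau 0 = 0 by rewrite -(scale0r 0) tauZ !scale0r.
have P0 : P 0.
  have i0 : wreath_invariant 0 by split; rewrite raddf0.
  rewrite -(mul0r 0); apply: (@PM 1 d.-1) => //; first by lia.
  by rewrite add1n prednK //; lia.
apply: (form_span (Q := fun h => P (tau (avg h)))) hf => [|h k ph pk|//|xs szxs xsf].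
- by rewrite -(scale0r 0); apply: PavgZ; rewrite /avg !sp0 tau0.
- by rewrite /avg (spD r1) (spD r2) (spD r3) tauD; apply: PD.
have [[e1 e2 e3] _] := form_prod xsf.
rewrite /avg (sign_part_eigen _ e1).
case: eqP => [w1|_]; last by rewrite !sp0 tau0.
rewrite (sign_part_eigen _ e2).
case: eqP => [w2|_]; last by rewrite sp0 tau0.
rewrite (sign_part_eigen _ e3).
case: eqP => [w3|_]; last by rewrite tau0.
apply: tau_forms => //; move: w1 w2 w3.
by case: (\big[_/_]_(_ <- _) _) => [[? ?] ?] /= -> -> ->.
Qed.

End Degree.
End Wreath.

(** * Generation in degree 8 *)

Lemma mpoly_hom_span (F : fieldType) n d (Q : {mpoly F[n]} -> Prop) : Q 0 ->
  (forall f h, Q f -> Q h -> Q (f + h)) -> (forall c f, Q f -> Q (c *: f)) ->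
  (forall ys : seq {mpoly F[n]}, size ys = d ->
     (forall y, y \in ys -> y \is 1.-homog) -> Q (\prod_(y <- ys) y)) ->
  forall f, f \is d.-homog -> Q f.
Proof.
move=> Q0 QD QZ Qp f /dhomogP hf; rewrite [f]mpolyE big_seq.
apply: (big_ind Q) => // m /hf /= md; apply: QZ.
pose ys : seq {mpoly F[n]} := flatten [seq nseq (m i) 'X_i | i <- enum 'I_n].
have -> : 'X_[m] = \prod_(y <- ys) y :> {mpoly F[n]}.
  rewrite mpolyXE_id big_flatten big_map big_enum; apply: eq_bigr => i _ /=.
  by rewrite big_nseq iter_mulr_1.
apply: Qp => [|y /flattenP[s /mapP[i _ ->]]].
  rewrite size_flatten /shape -map_comp -md mdegE sumnE big_map big_enum.
  by apply: eq_bigr => i _ /=; rewrite size_nseq.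
by rewrite mem_nseq => /andP[_ /eqP->]; rewrite dhomogX /= mdeg1.
Qed.

Lemma subalg_genZ (F : fieldType) (A : algType F) (X : A -> Prop) k a :
  subalg_gen X a -> subalg_gen X (k *: a).
Proof.
by move=> Xa; rewrite -mulr_algl; apply: subalg_gen_mul => //; apply: subalg_gen_scalar.
Qed.

Section UpperBound.

Variables (F : fieldType) (gT : finGroupType) (G : {group gT}).
Hypotheses (two_neq0 : 2%:R != 0 :> F) (three_neq0 : 3%:R != 0 :> F).
Variables a1 a2 a3 c : gT.
Hypothesis gensG : [set a1; a2; a3; c] \subset G.
Hypothesis genG : G \subset <<[set a1; a2; a3; c]>>%g.
Hypothesis rels :
  [/\ a1 * a1 = 1, a2 * a2 = 1, a3 * a3 = 1 & c * c * c = 1]%g /\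
  [/\ a2 * a1 = a1 * a2, a3 * a1 = a1 * a3 & a3 * a2 = a2 * a3]%g /\
  [/\ c * a1 = a3 * c, c * a2 = a1 * c & c * a3 = a2 * c]%g.
Variables (n : nat) (V : mx_representation F G n).

(** By induction on the degree, the subalgebra generated in degrees at most 8 contains
all products of invariants of smaller degrees, so it can serve as the subspace of
decomposables. *)
Lemma homog_invariants_generated d f : f \is d.-homog -> invariant V f ->
  subalg_gen (invariant_homog_le V 8) f.
Proof.
have [d8|d9] := leqP d 8.
  by move=> hf If; apply: subalg_gen_mem; split=> //; exists d.
elim/ltn_ind: d d9 f => d IHd d9 f hf If.
have IH e h : (e < d)%N -> h \is e.-homog -> invariant V h ->
    subalg_gen (invariant_homog_le V 8) h.
  move=> ed hh Ih; have [e8|e9] := leqP e 8; last exact: (IHd e).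
  by apply: subalg_gen_mem; split=> //; exists e.
have [m1 m2 m3 m4] : [/\ a1 \in G, a2 \in G, a3 \in G & c \in G].
  by split; apply: (subsetP gensG); rewrite !inE eqxx ?orbT.
have [[e1 e2 e3 e4] [[e5 e6 e7] [e8 e9 e10]]] := rels.
have inv2 x : x \in G -> (x * x = 1)%g -> involutive (sym_act V x).
  by move=> xG xx h; rewrite sym_act_comp // xx sym_act1.
have act_comm x y z t h : x \in G -> y \in G -> z \in G -> t \in G ->
    (y * x = t * z)%g -> sym_act V x (sym_act V y h) = sym_act V z (sym_act V t h).
  by move=> xG yG zG tG E; rewrite sym_act_comp // E -sym_act_comp.
have invP h : wreath_invariant (sym_act V a1) (sym_act V a2) (sym_act V a3)
    (sym_act V c) h -> invariant V h.
  move=> [h1 h2 h3 hc]; apply: invariant_gen gensG genG _ => x.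
  by rewrite 3!in_setU !in_set1 -!orbA => /or4P[] /eqP ->.
pose hom e (h : {mpoly F[n]}) : Prop := h \is e.-homog.
have Phom x e h : hom e h -> hom e (sym_act V x h) by exact: sym_act_homog.
have PM i j u v : (0 < i)%N -> (0 < j)%N -> (i + j = d)%N ->
    wreath_invariant (sym_act V a1) (sym_act V a2) (sym_act V a3) (sym_act V c) u ->
    wreath_invariant (sym_act V a1) (sym_act V a2) (sym_act V a3) (sym_act V c) v ->
    hom i u -> hom j v -> subalg_gen (invariant_homog_le V 8) (u * v).
  move=> gi gj ij /invP Iu /invP Iv hu hv.
  have id : (i < d)%N by rewrite -ij -[X in (X < _)%N]addn0 ltn_add2l.
  have jd : (j < d)%N by rewrite -ij -[X in (X < _)%N]add0n ltn_add2r.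
  exact: subalg_gen_mul (IH i u id hu Iu) (IH j v jd hv Iv).
have wf : wreath_invariant (sym_act V a1) (sym_act V a2) (sym_act V a3)
    (sym_act V c) f by split; apply: If.
have gK h : sym_act V c (sym_act V c (sym_act V c h)) = h.
  by rewrite !sym_act_comp ?groupM // mulgA e4 sym_act1.
have h0 e : hom e 0 by exact: dhomog0.
have h1 : hom 0%N 1 by exact: dhomog1.
have hD e u v : hom e u -> hom e v -> hom e (u + v) by exact: rpredD.
have hZ e k u : hom e u -> hom e (k *: u) by exact: rpredZ.
have hM e e' u v : hom e u -> hom e' v -> hom (e + e')%N (u * v).
  exact: dhomogM.
apply: (wreath_decomposable two_neq0 three_neq0 h0 h1 hD hZ hM
  (@mpoly_hom_span F n) (Phom a1) (Phom a2) (Phom a3) (Phom c)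
  (inv2 _ m1 e1) (inv2 _ m2 e2) (inv2 _ m3 e3) gK
  (fun h => act_comm _ _ _ _ h m1 m2 m2 m1 e5)
  (fun h => act_comm _ _ _ _ h m1 m3 m3 m1 e6)
  (fun h => act_comm _ _ _ _ h m2 m3 m3 m2 e7)
  (fun h => act_comm _ _ _ _ h m1 m4 m4 m3 e8)
  (fun h => act_comm _ _ _ _ h m2 m4 m4 m1 e9)
  (fun h => act_comm _ _ _ _ h m3 m4 m4 m2 e10)
  _ _ PM d9 hf wf).
- exact: subalg_gen_add.
- exact: subalg_genZ.
Qed.

Lemma invariants_generated8 : invariants_generated_in V 8.
Proof.
move=> f If; rewrite [f](pihomog_partitionE (leqnn (mmeasure mdeg f))).
apply: (big_ind (subalg_gen (invariant_homog_le V 8))).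
- by rewrite -(scale0r 1); apply: subalg_gen_scalar.
- exact: subalg_gen_add.
move=> i _; apply: (homog_invariants_generated (pihomogP _ i f)) => x xG.
by rewrite sym_act_pihomog If.
Qed.

End UpperBound.

(** * The group A_4 x C_2 as a wreath product *)

Definition pt0 : 'I_4 := @Ordinal 4 0 isT.
Definition pt1 : 'I_4 := @Ordinal 4 1 isT.
Definition pt2 : 'I_4 := @Ordinal 4 2 isT.
Definition pt3 : 'I_4 := @Ordinal 4 3 isT.

Definition klein1 : {perm 'I_4} := (tperm pt0 pt1 * tperm pt2 pt3)%g.
Definition klein2 : {perm 'I_4} := (tperm pt0 pt2 * tperm pt1 pt3)%g.
Definition klein3 : {perm 'I_4} := (tperm pt0 pt3 * tperm pt1 pt2)%g.
Definition rot3 : {perm 'I_4} := (tperm pt1 pt2 * tperm pt1 pt3)%g.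

Lemma ord4P (P : 'I_4 -> Prop) : P pt0 -> P pt1 -> P pt2 -> P pt3 -> forall i, P i.
Proof.
move=> p0 p1 p2 p3 [[|[|[|[|//]]]] lt].
- by rewrite (_ : Ordinal lt = pt0) //; exact: val_inj.
- by rewrite (_ : Ordinal lt = pt1) //; exact: val_inj.
- by rewrite (_ : Ordinal lt = pt2) //; exact: val_inj.
- by rewrite (_ : Ordinal lt = pt3) //; exact: val_inj.
Qed.

Lemma klein1E :
  [/\ klein1 pt0 = pt1, klein1 pt1 = pt0, klein1 pt2 = pt3 & klein1 pt3 = pt2].
Proof. by split; rewrite !permE /= !permE /=. Qed.
Lemma klein2E :
  [/\ klein2 pt0 = pt2, klein2 pt1 = pt3, klein2 pt2 = pt0 & klein2 pt3 = pt1].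
Proof. by split; rewrite !permE /= !permE /=. Qed.
Lemma klein3E :
  [/\ klein3 pt0 = pt3, klein3 pt1 = pt2, klein3 pt2 = pt1 & klein3 pt3 = pt0].
Proof. by split; rewrite !permE /= !permE /=. Qed.
Lemma rot3E :
  [/\ rot3 pt0 = pt0, rot3 pt1 = pt2, rot3 pt2 = pt3 & rot3 pt3 = pt1].
Proof. by split; rewrite !permE /= !permE /=. Qed.

Lemma klein_rot3_relations :
  [/\ klein1 * klein1 = 1, klein2 * klein2 = 1, klein3 * klein3 = 1 &
      rot3 * rot3 * rot3 = 1]%g /\
  [/\ klein1 * klein2 = klein3, klein2 * klein1 = klein3,
      klein2 * klein3 = klein1, klein3 * klein2 = klein1 &
      klein1 * klein3 = klein2]%g /\
  [/\ klein3 * klein1 = klein2, rot3 * klein1 = klein3 * rot3,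
      rot3 * klein2 = klein1 * rot3 & rot3 * klein3 = klein2 * rot3]%g.
Proof.
move: klein1 klein2 klein3 rot3 klein1E klein2E klein3E rot3E =>
  k k' k'' d [? ? ? ?] [? ? ? ?] [? ? ? ?] [? ? ? ?].
do ![split]; apply/permP; apply: ord4P; rewrite !permM ?perm1; congruence.
Qed.

Lemma klein_rot3_even : [/\ klein1 \in alt.Alt 'I_4, klein2 \in alt.Alt 'I_4,
  klein3 \in alt.Alt 'I_4 & rot3 \in alt.Alt 'I_4].
Proof. by split; rewrite alt.Alt_even odd_permM !odd_tperm. Qed.

Local Notation gT := ({perm 'I_4} * 'Z_2)%type.

(** Twisting the Klein involutions by the generator of C_2 gives involutions that are
independent: their product is that generator, whereas the Klein involutions
themselves have product 1. *)
Definition gen1 : gT := (klein1, 1%R).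
Definition gen2 : gT := (klein2, 1%R).
Definition gen3 : gT := (klein3, 1%R).
Definition gen_rot : gT := (rot3, 0%R).

Lemma wreath_relations :
  [/\ gen1 * gen1 = 1, gen2 * gen2 = 1, gen3 * gen3 = 1 &
      gen_rot * gen_rot * gen_rot = 1]%g /\
  [/\ gen2 * gen1 = gen1 * gen2, gen3 * gen1 = gen1 * gen3 &
      gen3 * gen2 = gen2 * gen3]%g /\
  [/\ gen_rot * gen1 = gen3 * gen_rot, gen_rot * gen2 = gen1 * gen_rot &
      gen_rot * gen3 = gen2 * gen_rot]%g.
Proof.
have [[e1 e2 e3 e4] [[e5 e6 e7 e8 e9] [e10 e11 e12 e13]]] := klein_rot3_relations.
have pairE (x y x' y' : {perm 'I_4}) (u v u' v' : 'Z_2) :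
    (x * y = x' * y')%g -> (u * v = u' * v')%g ->
    ((x, u) * (y, v) = (x', u') * (y', v') :> gT)%g.
  by move=> xE uE; rewrite -[LHS]/((x * y)%g, (u * v)%g) xE uE.
have oneE : (1 = (1, 1) * (1, 1) :> gT)%g by rewrite mulg1.
do ![split].
- by rewrite [RHS]oneE; apply: pairE; [rewrite e1 mulg1 | apply: val_inj].
- by rewrite [RHS]oneE; apply: pairE; [rewrite e2 mulg1 | apply: val_inj].
- by rewrite [RHS]oneE; apply: pairE; [rewrite e3 mulg1 | apply: val_inj].
- rewrite [RHS]oneE; apply: pairE; first by rewrite e4 mulg1.
  exact: val_inj.
- by apply: pairE => //; rewrite e5 e6.
- by apply: pairE => //; rewrite e9 e10.
- by apply: pairE => //; rewrite e7 e8.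
- by apply: pairE => //; apply: val_inj.
- by apply: pairE => //; apply: val_inj.
- by apply: pairE => //; apply: val_inj.
Qed.

Lemma mem_gens :
  [/\ gen1 \in A4xC2, gen2 \in A4xC2, gen3 \in A4xC2 & gen_rot \in A4xC2].
Proof. by have [] := klein_rot3_even; split; rewrite in_setX in_setT andbT. Qed.

Lemma card_A4xC2 : #|A4xC2| = 24%N.
Proof.
rewrite /A4xC2 /= cardsX cardsT card_ord.
by have := @alt.card_Alt 'I_4; rewrite card_ord => /(_ isT); rewrite mulnC => ->.
Qed.

(** By Lagrange: the generated subgroup contains an element of order 3 and the subgroup
of order 8 generated by the three involutions. *)
Lemma gens_A4xC2 : A4xC2 \subset <<[set gen1; gen2; gen3; gen_rot]>>%g.
Proof.
have [[e1 e2 e3 e4] [[e5 e6 e7] [e8 e9 e10]]] := wreath_relations.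
have [m1 m2 m3 m4] := mem_gens.
set H := <<_>>%g.
have [h1 h2 h3 h4] : [/\ gen1 \in H, gen2 \in H, gen3 \in H & gen_rot \in H].
  by split; apply: mem_gen; rewrite !inE eqxx ?orbT.
have HG : H \subset A4xC2.
  rewrite gen_subG; apply/subsetP => x.
  by rewrite 3!in_setU !in_set1 -!orbA => /or4P[] /eqP ->.
suff /eqP-> : H == A4xC2 by [].
rewrite eqEcard HG card_A4xC2 dvdn_leq ?cardG_gt0 //.
have n1 : klein1 != 1%g by apply/eqP => /permP/(_ pt0); rewrite perm1; case: klein1E => ->.
have n2 : klein2 != 1%g by apply/eqP => /permP/(_ pt0); rewrite perm1; case: klein2E => ->.
have n4 : rot3 != 1%g by apply/eqP => /permP/(_ pt1); rewrite perm1; case: rot3E => _ ->.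
have n12 : klein1 != klein2.
  by apply/eqP => /permP/(_ pt0); case: klein1E => ->; case: klein2E => ->.
have o x : (x * x = 1)%g -> x.1 != 1%g -> #[x : gT]%g = 2%N.
  move=> xx x1; apply: nt_prime_order => //.
  by apply: contraNneq x1 => ->.
have o1 := o _ e1 n1; have o2 := o _ e2 n2.
have oc : #[gen_rot]%g = 3%N.
  apply: nt_prime_order => //; first by rewrite -e4 -mulgA.
  by apply: contraNneq n4 => cE; rewrite -[rot3]/(gen_rot.1) cE.
have o3 : #[gen3]%g = 2%N.
  apply: o => //; apply/eqP => /permP/(_ pt0); rewrite perm1; by case: klein3E => ->.
rewrite -[24%N]/(8 * 3)%N Gauss_dvd //; apply/andP; split; last first.
  by have := order_dvdG h4; rewrite oc.
set X := (<[gen1]> <*> <[gen2]>)%G.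
have XE : X = (<[gen1]> * <[gen2]>)%g :> {set _}.
  by rewrite /= cent_joinEr //; apply: cents_cycle.
have tiX : (<[gen1]> :&: <[gen2]> = 1)%g.
  apply: prime_TIg; first by rewrite -orderE o1.
  rewrite /= (cycle2g o1) subUset sub1G sub1set.
  rewrite (cycle2g o2) !inE negb_or; apply/andP; split.
    by apply: contraNneq n1 => aE; rewrite -[klein1]/(gen1.1) aE.
  by apply: contraNneq n12 => aE; rewrite -[klein1]/(gen1.1) aE.
have cX : #|X| = 4%N by rewrite XE (TI_cardMg tiX) -!orderE o1 o2.
have a3X : (<[gen3]> :&: X = 1)%g.
  apply: prime_TIg; first by rewrite -orderE o3.
  rewrite /= (cycle2g o3) subUset sub1G sub1set.
  rewrite XE; apply/imset2P => -[u v]; rewrite (cycle2g o1) (cycle2g o2) !inE.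
  have [k3i _ _ _] := klein3E.
  move=> /orP[] /eqP -> /orP[] /eqP ->.
  - by rewrite mulg1 => /(congr1 (fun x : gT => x.1 pt0)); rewrite k3i perm1.
  - by rewrite mul1g => /(congr1 (fun x : gT => x.1 pt0)); rewrite k3i; case: klein2E => ->.
  - by rewrite mulg1 => /(congr1 (fun x : gT => x.1 pt0)); rewrite k3i; case: klein1E => ->.
  - by move=> /(congr1 (fun x : gT => val x.2)).
have cX3 : X \subset 'C(<[gen3]>)%g.
  by rewrite join_subG; apply/andP; split; apply: cents_cycle.
have : (<[gen3]> <*> X)%g \subset H.
  by rewrite !join_subG !cycle_subG h1 h2 h3.
by move=> /cardSg; rewrite /= (cent_joinEr cX3) TI_cardMg // -orderE o3 cX.
Qed.

(** * The signed permutation module on ordered pairs of points *)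

Section SignedPermutation.

Variable F : fieldType.

Local Notation X := ('I_4 * 'I_4)%type.
Local Notation N := #|{: 'I_4 * 'I_4}|.
Local Notation gT := ({perm 'I_4} * 'Z_2)%type.

Definition pair_act (s : {perm 'I_4}) (x : X) : X := (s x.1, s x.2).

Definition signed_perm_mx (h : gT) : 'M[F]_N :=
  \matrix_(i, j) ((-1) ^+ (val h.2) *+ (enum_val j == pair_act h.1 (enum_val i))).

Lemma signed_perm_mx_repr : mx_repr A4xC2 signed_perm_mx.
Proof.
split=> [|[s e] [t f] _ _]; apply/matrixP => i k; rewrite !mxE /=.
  rewrite expr0 /pair_act !perm1 -surjective_pairing.
  by rewrite (inj_eq enum_val_inj) eq_sym.
rewrite (bigD1 (enum_rank (pair_act s (enum_val i)))) //= big1 ?addr0 => [|j ji].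
  rewrite !mxE /= enum_rankK eqxx mulr1n mulrnAr -exprD.
  rewrite /pair_act /= !permM; congr (_ *+ _).
  rewrite -[LHS]signr_odd -[RHS]signr_odd; congr (_ ^+ nat_of_bool _).
  by rewrite [LHS](_ : _ = odd ((e + f) %% 2)%N) // modn2 oddb.
rewrite mxE /=; case: eqP => [jE|_]; last by rewrite mulr0n mul0r.
by move: ji; rewrite -jE enum_valK eqxx.
Qed.

Definition signed_perm : mx_representation F A4xC2 N :=
  MxRepresentation signed_perm_mx_repr.

Definition pair_var (x : X) : {mpoly F[N]} := 'X_(enum_rank x).

Lemma sym_act_pair_var h x : sym_act signed_perm h (pair_var x) =
  (-1) ^+ (val h.2) *: pair_var (pair_act h.1 x).
Proof.
rewrite sym_actX (bigD1 (enum_rank (pair_act h.1 x))) //= big1 ?addr0 => [|j jx].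
  by rewrite mxE !enum_rankK eqxx mulr1n.
rewrite mxE enum_rankK; case: eqP => [jE|_]; last by rewrite mulr0n scale0r.
by move: jx; rewrite -jE enum_valK eqxx.
Qed.

End SignedPermutation.

(** * Coefficients of a polynomial along a plane *)

Lemma mpoly_ring_ind (R : nzRingType) n (P : {mpoly R[n]} -> Prop) :
  (forall c, P c%:MP) -> (forall i, P 'X_i) ->
  (forall f h, P f -> P h -> P (f + h)) ->
  (forall f h, P f -> P h -> P (f * h)) -> forall f, P f.
Proof.
move=> PC PX PD PM f; rewrite [f]mpolyE.
apply: (big_ind P) => [||m _]; [by rewrite -mpolyC0 | exact: PD |].
rewrite -mul_mpolyC; apply: (PM) => //; rewrite mpolyXE_id.
apply: (big_ind P) => [||i _]; [by rewrite -mpolyC1 | exact: PM |].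
by elim: (m i) => [|k IHk]; [rewrite expr0 -mpolyC1 | rewrite exprS; apply: PM].
Qed.

Section Jets.

Variables (F : fieldType) (K : comNzRingType) (iota : {rmorphism F -> K}).
Variable n : nat.
Local Notation Q := {poly {poly K}}.

(** The point s v + e u, where the outer variable is s and the inner one is e. *)
Definition line (v u : 'I_n -> K) (x : 'I_n) : Q :=
  ((u x)%:P * 'X)%:P + (v x)%:P%:P * 'X.

Definition iotaP : F -> Q := polyC \o (polyC \o iota).
HB.instance Definition _ := GRing.RMorphism.copy iotaP (polyC \o (polyC \o iota)).

Definition jet_poly (v u : 'I_n -> K) : {mpoly F[n]} -> Q := mmap iotaP (line v u).

Fact jet_key : unit. Proof. exact: tt. Qed.
(** The coefficient of s^i e^j in f (s v + e u).  It is locked so that it is only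
manipulated through its behaviour on constants, variables, sums and products. *)
Definition jet := locked_with jet_key
  (fun (v u : 'I_n -> K) (f : {mpoly F[n]}) (i j : nat) => (jet_poly v u f)`_i`_j).

Lemma jetE v u f i j : jet v u f i j = (jet_poly v u f)`_i`_j.
Proof. by rewrite /jet locked_withE. Qed.

Lemma jetC v u k i j :
  jet v u k%:MP i j = if (i == 0) && (j == 0) then iota k else 0.
Proof.
rewrite jetE /jet_poly mmapC /= coefC; case: i => [|i] /=; last by rewrite coef0.
by rewrite coefC.
Qed.

Lemma jetX v u x i j : jet v u 'X_x i j =
  (if (i == 0) && (j == 1) then u x else 0) +
  (if (i == 1) && (j == 0) then v x else 0).
Proof.
rewrite jetE /jet_poly mmapX mmap1U /line coefD coefC coefMX coefC coefD.
case: i => [|[|i]] /=; rewrite ?coef0 ?addr0 ?add0r.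
- by rewrite coefMX coefC; case: j => [|[|j]].
- by rewrite coefC; case: j.
- by [].
Qed.

Lemma jetD v u f h i j : jet v u (f + h) i j = jet v u f i j + jet v u h i j.
Proof. by rewrite !jetE /jet_poly mmapD !coefD. Qed.

Lemma jetM v u f h i j : jet v u (f * h) i j =
  \sum_(a < i.+1) \sum_(b < j.+1) jet v u f a b * jet v u h (i - a) (j - b).
Proof.
rewrite jetE /jet_poly rmorphM coefM coef_sum; apply: eq_bigr => a _.
by rewrite coefM; apply: eq_bigr => b _; rewrite !jetE.
Qed.

Lemma jetZ v u k f i j : jet v u (k *: f) i j = iota k * jet v u f i j.
Proof.
rewrite -mul_mpolyC jetM big_ord_recl [X in _ + X]big1 ?addr0 => [|a _].
  rewrite big_ord_recl [X in _ + X]big1 ?addr0 => [|b _].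
    by rewrite jetC /= !subn0.
  by rewrite jetC /= mul0r.
by rewrite big1 // => b _; rewrite jetC /= mul0r.
Qed.

Lemma jet_scale v u al be f i j :
  jet (fun x => al * v x) (fun x => be * u x) f i j =
  al ^+ i * be ^+ j * jet v u f i j.
Proof.
elim/mpoly_ring_ind: f i j => [k|x|f h ef eh|f h ef eh] i j.
- by rewrite !jetC; case: i j => [|i] [|j]; rewrite /= ?mulr0 // !expr0 !mul1r.
- rewrite !jetX mulrDr; congr (_ + _).
    by case: i j => [|i] [|[|j]] /=; rewrite ?expr0 ?expr1 ?mulr0 ?mul1r.
  by case: i j => [|[|i]] [|j] /=; rewrite ?expr0 ?expr1 ?mulr0 ?mulr1.
- by rewrite !jetD ef eh mulrDr.
rewrite !jetM mulr_sumr; apply: eq_bigr => a _.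
rewrite mulr_sumr; apply: eq_bigr => b _; rewrite ef eh.
have ai : (a <= i)%N by rewrite -ltnS.
have bj : (b <= j)%N by rewrite -ltnS.
have -> : al ^+ i = al ^+ a * al ^+ (i - a) by rewrite -exprD subnKC.
have -> : be ^+ j = be ^+ b * be ^+ (j - b) by rewrite -exprD subnKC.
by ring.
Qed.

Lemma jet0 v v' u f j : jet v u f 0 j = jet v' u f 0 j.
Proof.
elim/mpoly_ring_ind: f j => [k|x|f h ef eh|f h ef eh] j.
- by rewrite !jetC.
- by rewrite !jetX.
- by rewrite !jetD ef eh.
- by rewrite !jetM !big_ord1; apply: eq_bigr => b _; rewrite ef eh.
Qed.

Lemma jet1D v v' u f j :
  jet (fun x => v x + v' x) u f 1 j = jet v u f 1 j + jet v' u f 1 j.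
Proof.
elim/mpoly_ring_ind: f j => [k|x|f h ef eh|f h ef eh] j.
- by rewrite !jetC addr0.
- by rewrite !jetX; case: j => [|j]; rewrite /= !add0r // addr0.
- by rewrite !jetD ef eh addrACA.
have sumE (p q r : 'I_j.+1 -> K) : (forall b, p b = q b + r b) ->
    \sum_b p b = \sum_b q b + \sum_b r b.
  by move=> pqr; rewrite (eq_bigr _ (fun b _ => pqr b)) big_split.
have jet1M w : jet w u (f * h) 1 j =
    \sum_(b < j.+1) jet w u f 0 b * jet w u h 1 (j - b) +
    \sum_(b < j.+1) jet w u f 1 b * jet w u h 0 (j - b).
  by rewrite jetM big_ord_recl big_ord1.
rewrite !jet1M addrACA.
congr (_ + _); apply: sumE => b.
  by rewrite eh (jet0 (fun x => v x + v' x) v) (jet0 v' v) mulrDr.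
by rewrite ef (jet0 (fun x => v x + v' x) v) (jet0 v' v) mulrDl.
Qed.

Lemma jet_homog v u f d i j : f \is d.-homog -> (i + j != d)%N ->
  jet v u f i j = 0.
Proof.
pose H d (f : {mpoly F[n]}) := forall i j, (i + j != d)%N -> jet v u f i j = 0.
have HM e e' f1 f2 : H e f1 -> H e' f2 -> H (e + e')%N (f1 * f2).
  move=> h1 h2 a b ab; rewrite jetM big1 // => k _; rewrite big1 // => l _.
  have [kl|kl] := eqVneq (k + l)%N e; last by rewrite h1 ?mul0r.
  by rewrite [X in _ * X]h2 ?mulr0 //; have := ltn_ord k; have := ltn_ord l; lia.
have HC k : H 0 k%:MP by move=> a b; rewrite jetC; case: a b => [|a] [|b].
have H1 : H 0 1 by rewrite -mpolyC1.
move=> hf ijd; suff : H d f by apply.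
move/dhomogP: hf => hf; rewrite [f]mpolyE big_seq.
apply: (big_ind (H d)) => [a b _|f1 f2 h1 h2 a b ab|m /hf /= <-].
- by rewrite -mpolyC0 jetC rmorph0 if_same.
- by rewrite jetD h1 ?h2 ?addr0.
rewrite -mul_mpolyC -[mdeg m]add0n; apply: (HM) => //.
rewrite mpolyXE_id mdegE.
apply: (big_rec2 H) => // x e P _ hP; apply: (HM) => //.
elim: (m x) => [|k IHk]; first by rewrite expr0.
rewrite exprS -add1n; apply: (HM) => // a b ab; rewrite jetX.
by case: a b ab => [|[|a]] [|[|b]] //=; rewrite ?addr0.
Qed.

Lemma jet_ext v v' u u' f i j : v =1 v' -> u =1 u' ->
  jet v u f i j = jet v' u' f i j.
Proof.
move=> vv uu; elim/mpoly_ring_ind: f i j => [k|x|f h ef eh|f h ef eh] i j.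
- by rewrite !jetC.
- by rewrite !jetX vv uu.
- by rewrite !jetD ef eh.
- by rewrite !jetM; do 2!apply: eq_bigr => ? _; rewrite ef eh.
Qed.

Lemma jet_act (gT : finGroupType) (G : {group gT}) (V : mx_representation F G n)
    v u h f i j :
  jet v u (sym_act V h f) i j =
  jet (fun x => \sum_y iota (V h x y) * v y)
      (fun x => \sum_y iota (V h x y) * u y) f i j.
Proof.
elim/mpoly_ring_ind: f i j => [k|x|f1 f2 e1 e2|f1 f2 e1 e2] i j.
- by rewrite -[k%:MP]mulr1 mul_mpolyC linearZ /= rmorph1 -mul_mpolyC mulr1 !jetC.
- rewrite sym_actX jetX.
  have jet_sum (r : seq 'I_n) (c : 'I_n -> F) :
      jet v u (\sum_(y <- r) c y *: 'X_y) i j =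
      \sum_(y <- r) iota (c y) * jet v u 'X_y i j.
    elim: r => [|y r IHr]; first by rewrite !big_nil -mpolyC0 jetC rmorph0 if_same.
    by rewrite !big_cons jetD IHr jetZ.
  rewrite jet_sum; under eq_bigr => y _ do rewrite jetX mulrDr.
  rewrite big_split /=; congr (_ + _).
    by case: ifP => _ //; rewrite big1 // => y _; rewrite mulr0.
  by case: ifP => _ //; rewrite big1 // => y _; rewrite mulr0.
- by rewrite raddfD !jetD e1 e2.
- by rewrite rmorphM !jetM; do 2!apply: eq_bigr => ? _; rewrite e1 e2.
Qed.

End Jets.

(** * A criterion for invariants not generated below degree 8 *)

Section Criterion.

Variables (F : fieldType) (gT : finGroupType) (G : {group gT}).
Variables (n : nat) (V : mx_representation F G n).
Variables (K : comNzRingType) (iota : {rmorphism F -> K}).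
Hypothesis mul2I : forall x : K, x *+ 2 = 0 -> x = 0.
Hypothesis mul3I : forall x : K, x *+ 3 = 0 -> x = 0.
Variable w : K.
Hypothesis w2 : w ^+ 2 = - 1 - w.

Definition pt_act h (v : 'I_n -> K) (x : 'I_n) : K := \sum_y iota (V h x y) * v y.

Variables v u : 'I_n -> K.
Variables z g k1 k2 k3 : gT.
Hypotheses (zG : z \in G) (gG : g \in G).
Hypotheses (k1G : k1 \in G) (k2G : k2 \in G) (k3G : k3 \in G).
Hypotheses (zv : forall x, pt_act z v x = -1 * v x)
  (zu : forall x, pt_act z u x = -1 * u x).
Hypotheses (gv : forall x, pt_act g v x = w * v x)
  (gu : forall x, pt_act g u x = w ^+ 2 * u x).
Hypotheses (k1u : forall x, pt_act k1 u x = u x)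
  (k2u : forall x, pt_act k2 u x = u x) (k3u : forall x, pt_act k3 u x = u x).
Hypothesis kv : forall x,
  v x + pt_act k1 v x + (pt_act k2 v x + pt_act k3 v x) = 0 * v x.

Local Notation J := (jet iota v u).

Lemma jet_invariant h f i j : invariant V f -> h \in G ->
  J f i j = jet iota (pt_act h v) (pt_act h u) f i j.
Proof. by move=> If hG; rewrite -{1}(If h hG) jet_act. Qed.

(** The element z acts as -1 on v and u, so the coefficient is multiplied by
(-1)^(i + j). *)
Lemma jet_parity f i j : invariant V f -> odd (i + j) -> J f i j = 0.
Proof.
move=> If ij; apply: mul2I.
rewrite mulr2n {1}(jet_invariant i j If zG) (jet_ext iota f i j zv zu) jet_scale.
by rewrite -exprD -signr_odd ij expr1 mulN1r addNr.
Qed.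

Lemma omega_cubed : w ^+ 3 = 1.
Proof. by rewrite exprS w2 mulrBr -expr2 w2 mulrN1; ring. Qed.

(** The element g multiplies the coefficient by omega^(i + 2 j), and 1 - omega
divides 3. *)
Lemma jet_mod3 f i j : invariant V f -> ((i + 2 * j) %% 3 != 0)%N ->
  J f i j = 0.
Proof.
move=> If ij.
have E : w ^+ (i + 2 * j) * J f i j = J f i j.
  rewrite exprD exprM -jet_scale -(jet_ext iota f i j gv gu).
  by rewrite -(jet_invariant i j If gG).
have wE m : w ^+ m = w ^+ (m %% 3).
  by rewrite {1}(divn_eq m 3) exprD mulnC exprM omega_cubed expr1n mul1r.
suff wc : w * J f i j = J f i j.
  apply: mul3I; have wwc : w ^+ 2 * J f i j = J f i j.
    by rewrite expr2 -mulrA !wc.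
  have -> : J f i j *+ 3 = w ^+ 2 * J f i j + w * J f i j + J f i j.
    by rewrite wwc wc; ring.
  by rewrite w2; ring.
move: E ij; rewrite wE; case: (_ %% 3)%N (ltn_pmod (i + 2 * j) (isT : 0 < 3)%N).
  by [].
case=> [|[|//]] _ E _; first exact: E.
by rewrite -{1}E mulrA -exprS omega_cubed mul1r.
Qed.

(** The coefficient of s e is linear in v and unchanged when v is replaced by a
translate under an element fixing u, so four times it is its value at the sum of
four translates of v, which is zero. *)
Lemma jet11 f : invariant V f -> J f 1 1 = 0.
Proof.
move=> If; apply/mul2I/mul2I.
have Jk h : h \in G -> (forall x, pt_act h u x = u x) ->
    jet iota (pt_act h v) u f 1 1 = J f 1 1.
  move=> hG hu; rewrite (jet_invariant 1 1 If hG).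
  by apply: jet_ext => // x; rewrite hu.
have := jet_ext iota f 1 1 kv (fun x => erefl (u x)).
rewrite (jet1D iota (fun x => v x + pt_act k1 v x)).
rewrite !jet1D !Jk // -!mulr2n => ->.
have s01 := jet_scale iota v u 0 1 f 1 1; rewrite expr1 !mul0r in s01.
by rewrite -[RHS]s01; apply: jet_ext => // x; rewrite mul1r.
Qed.

(** In the product, the coefficient of s^a e^b of f meets that of s^(7-a) e^(1-b) of h.
Parity and the congruence modulo 3 leave (a, b) among (0,0), (6,0), (1,1) and
(7,1).  In (6,0) and (1,1) one factor is a coefficient of s e, hence zero; the
other two contain a coefficient of s^7 e. *)
Lemma jet71M f h : invariant V f -> invariant V h ->
  J f 7 1 = 0 -> J h 7 1 = 0 -> J (f * h) 7 1 = 0.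
Proof.
move=> If Ih f71 h71; rewrite jetM.
have kill a b : (a <= 7)%N -> (b <= 1)%N ->
    J f a b * J h (7 - a) (1 - b) = 0.
  move=> a7 b1.
  have [ab|ab] := boolP (odd (a + b)).
    by rewrite jet_parity ?mul0r.
  have [ab3|ab3] := boolP ((a + 2 * b) %% 3 != 0)%N.
    by rewrite jet_mod3 ?mul0r.
  move: b b1 ab ab3 => [|[|//]] _; rewrite ?addn0 ?muln0.
    move: a a7 => [|[|[|[|[|[|[|[|//]]]]]]]] // _ _ _; last by rewrite jet11 ?mulr0.
    by rewrite h71 mulr0.
  move: a a7 => [|[|[|[|[|[|[|[|//]]]]]]]] // _ _ _; last by rewrite f71 mul0r.
  by rewrite jet11 ?mul0r.
by rewrite big1 // => a _; rewrite big1 // => b _; apply: kill; rewrite -ltnS.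
Qed.

Lemma generation_degree_ge8 f d : invariant V f -> J f 7 1 != 0 ->
  invariants_generated_in V d -> (8 <= d)%N.
Proof.
move=> If f71 gen; rewrite leqNgt; apply/negP; rewrite ltnS => d7.
suff [_ f0] : invariant V f /\ J f 7 1 = 0 by rewrite f0 eqxx in f71.
elim: (gen f If) => [h [Ih [k kd hh]]|k|a b _ [Ia a0] _ [Ib b0]|a b _ [Ia a0] _ [Ib b0]].
- split=> //; apply: (jet_homog iota v u hh).
  by rewrite neq_ltn addn1 [X in _ || X]ltnS (leq_trans kd) ?orbT.
- split; first by move=> h hG; rewrite linearZ /= rmorph1.
  by rewrite jetZ -mpolyC1 jetC mulr0.
- by split; [move=> h hG; rewrite rmorphD /= Ia ?Ib | rewrite jetD a0 b0 addr0].
- by split; [move=> h hG; rewrite rmorphM /= Ia ?Ib | exact: jet71M].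
Qed.

End Criterion.

(** * An indecomposable invariant of degree 8 *)

Section Table.

Variables (S : comNzRingType) (w : S).

(** Functions on ordered pairs of points: v is supported on the diagonal, where it is
(0, 1, w, w^2); u is constant on the three partitions of the four points into two
pairs, with the values 1, w^2, w, and vanishes on the diagonal. *)
Definition vrow : seq S := [:: 0; 1; w; w ^+ 2].
Definition utab : seq (seq S) :=
  [:: [:: 0; 1; w ^+ 2; w]; [:: 1; 0; w; w ^+ 2];
      [:: w ^+ 2; w; 0; 1]; [:: w; w ^+ 2; 1; 0]].
Definition vpt (i j : nat) : S := if i == j then vrow`_i else 0.
Definition upt (i j : nat) : S := (nth [::] utab i)`_j.

Lemma table_witness (e s : S) : w ^+ 2 = - 1 - w ->
  let t i j := upt i j * e + vpt i j * s in
  (\sum_(i < 4) t i i ^+ 3) *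
    (\sum_(i < 4) \sum_(j < 4) t i j * t i i ^+ 2 * t j j ^+ 2) =
  18%:R * e * s ^+ 7.
Proof.
move=> w2 t; rewrite !big_ord_recl !big_ord0 /= /t /upt /vpt /= /bump /=.
ring: w2.
Qed.

End Table.

Lemma rmorph_upt (S S' : comNzRingType) (p : {rmorphism S -> S'}) w (i j : 'I_4) :
  p (upt w i j) = upt (p w) i j.
Proof.
move: i j; do 2![apply: ord4P];
by rewrite /upt /= ?rmorphXn ?rmorph0 ?rmorph1.
Qed.

Lemma rmorph_vpt (S S' : comNzRingType) (p : {rmorphism S -> S'}) w (i j : 'I_4) :
  p (vpt w i j) = vpt (p w) i j.
Proof.
move: i j; do 2![apply: ord4P];
by rewrite /vpt /= ?rmorphXn ?rmorph0 ?rmorph1.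
Qed.

Section PointSymmetry.

Variables (S : comNzRingType) (w : S).
Hypothesis w2 : w ^+ 2 = - 1 - w.

Lemma upt_rot3 (i j : 'I_4) : upt w (rot3 i) (rot3 j) = w ^+ 2 * upt w i j.
Proof.
move: rot3 rot3E => d [d0 d1 d2 d3]; move: i j; do 2![apply: ord4P];
by rewrite ?(d0, d1, d2, d3) /upt /=; ring: w2.
Qed.

Lemma vpt_rot3 (i j : 'I_4) : vpt w (rot3 i) (rot3 j) = w * vpt w i j.
Proof.
move: rot3 rot3E => d [d0 d1 d2 d3]; move: i j; do 2![apply: ord4P];
by rewrite ?(d0, d1, d2, d3) /vpt /=; ring: w2.
Qed.

Lemma upt_klein (i j : 'I_4) : [/\ upt w (klein1 i) (klein1 j) = upt w i j,
  upt w (klein2 i) (klein2 j) = upt w i j & upt w (klein3 i) (klein3 j) = upt w i j].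
Proof.
move: klein1 klein2 klein3 klein1E klein2E klein3E =>
  k k' k'' [a0 a1 a2 a3] [b0 b1 b2 b3] [d0 d1 d2 d3].
by move: i j; do 2![apply: ord4P];
  rewrite ?(a0, a1, a2, a3) ?(b0, b1, b2, b3) ?(d0, d1, d2, d3).
Qed.

Lemma vpt_klein_sum (i j : 'I_4) :
  vpt w i j + vpt w (klein1 i) (klein1 j) +
  (vpt w (klein2 i) (klein2 j) + vpt w (klein3 i) (klein3 j)) = 0.
Proof.
move: klein1 klein2 klein3 klein1E klein2E klein3E =>
  k k' k'' [a0 a1 a2 a3] [b0 b1 b2 b3] [d0 d1 d2 d3].
by move: i j; do 2![apply: ord4P];
  rewrite ?(a0, a1, a2, a3) ?(b0, b1, b2, b3) ?(d0, d1, d2, d3) /vpt /=; ring: w2.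
Qed.

End PointSymmetry.

Section Witness.

Variable F : fieldType.
Hypotheses (two_neq0 : 2%:R != 0 :> F) (three_neq0 : 3%:R != 0 :> F).

Definition cyclo3 : {poly F} := 'X^2 + 'X + 1.
Local Notation K := {poly %/ cyclo3}.
Definition omega : K := in_qpoly cyclo3 'X.

Lemma omega2 : omega ^+ 2 = - 1 - omega.
Proof.
have sz : size cyclo3 = 3%N.
  by rewrite /cyclo3 -addrA size_polyDl size_polyXn // size_XaddC.
have mon : cyclo3 \is monic.
  rewrite /cyclo3 -addrA monicE lead_coefDl ?lead_coefXn //.
  by rewrite size_polyXn size_XaddC.
have mk : mk_monic cyclo3 = cyclo3 by rewrite /mk_monic sz mon.
have e0 : in_qpoly cyclo3 cyclo3 = 0.
  by apply: val_inj; rewrite /= mk Pdiv.RingMonic.rmodpp.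
have : omega ^+ 2 + omega + 1 = 0.
  rewrite -e0 /omega -in_qpoly1 -rmorphXn -!rmorphD //.
by move=> e; rewrite -[LHS](subr0) -e; ring.
Qed.

(** K need not be a field, but it is an algebra over F. *)
Lemma natr_neq0_mulI m : m%:R != 0 :> F -> forall x : K, x *+ m = 0 -> x = 0.
Proof.
move=> m0 x; rewrite -mulr_natl => e.
have : qpolyC cyclo3 (m%:R)^-1 * (m%:R * x) = 0 by rewrite e mulr0.
rewrite mulrA -(rmorph_nat (qpolyC cyclo3)) -rmorphM mulVf // rmorph1 mul1r.
by [].
Qed.

Local Notation X := ('I_4 * 'I_4)%type.
Local Notation N := #|{: 'I_4 * 'I_4}|.

Lemma pt_act_signed (p : X -> K) h x :
  pt_act (signed_perm F) (qpolyC cyclo3) h (fun i => p (enum_val i)) x =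
  (-1) ^+ (val h.2) * p (pair_act h.1 (enum_val x)).
Proof.
rewrite /pt_act (bigD1 (enum_rank (pair_act h.1 (enum_val x)))) //= big1 ?addr0.
  by rewrite mxE !enum_rankK eqxx mulr1n rmorphXn rmorphN1.
move=> y yx; rewrite mxE; case: eqP => [jE|_].
  by move: yx; rewrite -jE enum_valK eqxx.
by rewrite mulr0n rmorph0 mul0r.
Qed.

Definition diag_var (i : 'I_4) : {mpoly F[N]} := pair_var F (i, i).
(** In both factors a monomial of odd degree is summed over a set that the group
permutes, so the sign of the action appears once in each factor. *)
Definition witness : {mpoly F[N]} :=
  (\sum_i diag_var i ^+ 3) * (\sum_(x : X) pair_var F x * diag_var x.1 ^+ 2 * diag_var x.2 ^+ 2).

Lemma witness_invariant : invariant (signed_perm F) witness.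
Proof.
move=> h _; rewrite /witness rmorphM /= !raddf_sum /=.
pose s : F := (-1) ^+ (val h.2).
have sT x : sym_act (signed_perm F) h (pair_var F x) = s *: pair_var F (pair_act h.1 x).
  exact: sym_act_pair_var.
have s2 : s ^+ 2 = 1 by rewrite /s -exprM mulnC exprM sqrrN expr1n expr1n.
have sD i : sym_act (signed_perm F) h (diag_var i) = s *: diag_var (h.1 i) by rewrite sT.
have -> : \sum_i sym_act (signed_perm F) h (diag_var i ^+ 3) =
    s *: \sum_i diag_var i ^+ 3.
  rewrite scaler_sumr [RHS](reindex_inj (@perm_inj _ h.1)) /=.
  apply: eq_bigr => i _; rewrite rmorphXn /= sD exprZn.
  by rewrite exprS s2 mulr1.
have pair_inj : injective (pair_act h.1).
  by move=> [a b] [a' b'] [/perm_inj -> /perm_inj ->].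
have -> : \sum_(x : X) sym_act (signed_perm F) h
      (pair_var F x * diag_var x.1 ^+ 2 * diag_var x.2 ^+ 2) =
    s *: \sum_(x : X) pair_var F x * diag_var x.1 ^+ 2 * diag_var x.2 ^+ 2.
  rewrite scaler_sumr [RHS](reindex_inj pair_inj) /=.
  apply: eq_bigr => x _; rewrite 2!rmorphM 2!rmorphXn /= !sD sT !exprZn s2 !scale1r.
  by rewrite !scalerAl.
by rewrite -scalerAl -scalerAr scalerA -expr2 s2 scale1r.
Qed.

Lemma rmorph_witness (S : comNzRingType) (p : {rmorphism {mpoly F[N]} -> S})
    (t : 'I_4 -> 'I_4 -> S) : (forall i j, p (pair_var F (i, j)) = t i j) ->
  p witness = (\sum_i t i i ^+ 3) *
    (\sum_i \sum_j t i j * t i i ^+ 2 * t j j ^+ 2).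
Proof.
move=> pT; rewrite /witness rmorphM !rmorph_sum /=; congr (_ * _).
  by apply: eq_bigr => i _; rewrite rmorphXn /= pT.
rewrite pair_bigA; apply: eq_bigr => -[i j] _ /=.
by rewrite 2!rmorphM 2!rmorphXn /= !pT.
Qed.

Local Notation v := (fun x : 'I_N => vpt omega (enum_val x).1 (enum_val x).2).
Local Notation u := (fun x : 'I_N => upt omega (enum_val x).1 (enum_val x).2).

Lemma jet_witness : jet (qpolyC cyclo3) v u witness 7 1 = 18%:R.
Proof.
pose W : {poly {poly K}} := omega%:P%:P.
have W2 : W ^+ 2 = - 1 - W.
  by rewrite /W -!polyC_exp omega2 !(polyCB, polyCN, polyC1).
rewrite jetE /jet_poly.
rewrite (@rmorph_witness _ (mmap (iotaP (qpolyC cyclo3)) (line v u))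
   (fun i j => upt W i j * 'X%:P + vpt W i j * 'X)); last first.
  move=> i j; rewrite /= /pair_var mmapX mmap1U /line enum_rankK /=.
  by rewrite polyCM -(rmorph_upt (polyC \o polyC)) -(rmorph_vpt (polyC \o polyC)).
rewrite (table_witness _ _ W2) coefMXn /=.
have -> : 18%:R * 'X%:P = (18%:R * 'X)%:P :> {poly {poly K}}.
  by rewrite polyCM (rmorph_nat polyC).
rewrite coefC /= -(rmorph_nat polyC) coefCM coefX mulr1.
by [].
Qed.

Lemma witness_neq0 : jet (qpolyC cyclo3) v u witness 7 1 != 0.
Proof.
rewrite jet_witness; apply/eqP => e.
have e2 : (9%:R : K) = 0.
  by apply: (natr_neq0_mulI two_neq0); rewrite -mulrnA.
have e3 : (3%:R : K) = 0.
  by apply: (natr_neq0_mulI three_neq0); rewrite -mulrnA.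
have /eqP := natr_neq0_mulI three_neq0 (e3 : 1 *+ 3 = 0).
by rewrite oner_eq0.
Qed.

Lemma signed_perm_generation_degree d :
  invariants_generated_in (signed_perm F) d -> (8 <= d)%N.
Proof.
have [e1 e2 e3 e4] := klein_rot3_even.
have mem (s : {perm 'I_4}) (t : 'Z_2) : s \in alt.Alt 'I_4 -> (s, t) \in A4xC2.
  by move=> sA; rewrite in_setX in_setT andbT.
have vA := pt_act_signed (fun y => vpt omega y.1 y.2).
have uA := pt_act_signed (fun y => upt omega y.1 y.2).
pose z : {perm 'I_4} * 'Z_2 := (1%g, 1%R).
pose gen (s : {perm 'I_4}) : {perm 'I_4} * 'Z_2 := (s, 0%R).
apply: (@generation_degree_ge8 _ _ _ _ (signed_perm F) _ (qpolyC cyclo3)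
  (natr_neq0_mulI two_neq0) (natr_neq0_mulI three_neq0) omega omega2 v u
  z (gen rot3) (gen klein1) (gen klein2) (gen klein3)) witness_invariant witness_neq0.
- exact: mem (group1 _).
- exact: mem.
- exact: mem.
- exact: mem.
- exact: mem.
- by move=> x; rewrite vA /= expr1 !perm1.
- by move=> x; rewrite uA /= expr1 !perm1.
- by move=> x; rewrite vA /= expr0 mul1r; exact: vpt_rot3 omega2 _ _.
- by move=> x; rewrite uA /= expr0 mul1r; exact: upt_rot3 omega2 _ _.
- move=> x; rewrite uA /= expr0 mul1r.
  by have [] := upt_klein omega (enum_val x).1 (enum_val x).2.
- move=> x; rewrite uA /= expr0 mul1r.
  by have [] := upt_klein omega (enum_val x).1 (enum_val x).2.
- move=> x; rewrite uA /= expr0 mul1r.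
  by have [] := upt_klein omega (enum_val x).1 (enum_val x).2.
move=> x; rewrite !vA /= expr0 !mul1r mul0r.
exact: vpt_klein_sum omega2 _ _.
Qed.

End Witness.

(** * The Noether number *)

Lemma is_beta_exists (F : fieldType) (gT : finGroupType) (G : {group gT}) n
    (V : mx_representation F G n) d :
  invariants_generated_in V d -> exists2 d', is_beta V d' & (d' <= d)%N.
Proof.
elim/ltn_ind: d => d IHd gd.
have [[d' d'd gd']|min] :=
    classic (exists2 d', (d' < d)%N & invariants_generated_in V d').
  have [e be ed'] := IHd d' d'd gd'.
  by exists e => //; apply: leq_trans ed' (ltnW d'd).
exists d => //; split=> // d' gd'; rewrite leqNgt; apply/negP => d'd.
by apply: min; exists d'.
Qed.

Theorem proposition3p8 (F : fieldType)
    (char_neq2 : 2%N \notin [pchar F]) (char_neq3 : 3%N \notin [pchar F]) :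
  is_noether_number F A4xC2 8.
Proof.
have two_neq0 : 2%:R != 0 :> F by move: char_neq2; rewrite !inE.
have three_neq0 : 3%:R != 0 :> F by move: char_neq3; rewrite !inE.
have gens : [set gen1; gen2; gen3; gen_rot] \subset A4xC2.
  have [m1 m2 m3 m4] := mem_gens; apply/subsetP => x.
  by rewrite 3!in_setU !in_set1 -!orbA => /or4P[] /eqP ->.
have beta8 n (V : mx_representation F A4xC2 n) :
    exists2 d, is_beta V d & (d <= 8)%N.
  apply: is_beta_exists.
  exact: (invariants_generated8 two_neq0 three_neq0 gens gens_A4xC2 wreath_relations).
split=> // m ubm; have [d bd _] := beta8 _ (signed_perm F).
apply: leq_trans (ubm _ _ _ bd); case: bd => gd _.
exact: signed_perm_generation_degree two_neq0 three_neq0 _ gd.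
Qed.
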